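(* Let $\mathcal{I}$ be an ideal on $\omega$. Then the following statements are equivalent: (a) $\mathcal{I}$ is Ramsey. (b) For all $n\in\omega$ with $n\geq 2$, and for every $A\in\mathcal{I}^+$ together with every countable collection $\{\pi_m:[A]^n\to 2\}_{m\in\omega}$ of colorings of $[A]^n$, there exists $H\in\mathcal{I}^+$ with $H\subseteq A$ that is almost homogeneous for each $\pi_m$. (c) For all $n\in\omega$ with $n\geq 2$, for any sequence $\{k_m\}_{m\in\omega}\subseteq\omega$ such that each $k_m\geq 2$, and for every $A\in\mathcal{I}^+$ together with every countable collection $\{\pi_m:[A]^n\to k_m\}_{m\in\omega}$ of colorings of $[A]^n$, there exists $H\in\mathcal{I}^+$ with $H\subseteq A$ that is almost homogeneous for each $\pi_m$.
   Context: An ideal on $\omega$ is a family $\mathcal{I}\subseteq\wp(\omega)$ containing all finite sets, with $\omega\notin\mathcal{I}$, closed under subsets and finite unions. $\mathcal{I}^+$ is the family of infinite subsets of $\omega$ not in $\mathcal{I}$. $[A]^n$ is the family of subsets of $A$ of size $n$. A set $H\subseteq A$ is homogeneous for $\pi:[A]^n\to k$ if $\pi$ is constant on $[H]^n$. The ideal $\mathcal{I}$ is Ramsey if for every $A\in\mathcal{I}^+$ and every $\pi:[A]^2\to 2$ there is $H\in\mathcal{I}^+$, $H\subseteq A$, homogeneous for $\pi$. For an infinite set $H\subseteq\omega$ and $m\in\omega$, $H/m=\{j\in H: m<j\}$. An infinite subset $H$ of $A$ is almost homogeneous for $\pi:[A]^n\to k$ if there is $m\in\omega$ such that $H/m$ is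 homogeneous for $\pi$. *)

(* Defs.v *)
From mathcomp Require Import all_boot finmap.
From mathcomp Require Import boolp classical_sets cardinality.

Set Implicit Arguments.
Unset Strict Implicit.
Unset Printing Implicit Defensive.

Local Open Scope classical_set_scope.

Record is_ideal (I : set (set nat)) : Prop := IsIdeal {
  ideal_finite : forall A, finite_set A -> I A;
  ideal_proper : ~ I [set: nat];
  ideal_subset : forall A B, A `<=` B -> I B -> I A;
  ideal_setU : forall A B, I A -> I B -> I (A `|` B) }.

Definition positive (I : set (set nat)) : set (set nat) :=
  [set A | infinite_set A /\ ~ I A].

Definition nsubsets (A : set nat) (n : nat) : set {fset nat} :=
  [set s | [set` s] `<=` A /\ #|` s|%fset = n].

(* The domain is the subtype of {fset nat} given by [nsubsets A n]. *)
Definition coloring (A : set nat) (n k : nat) : Type := nsubsets A n -> 'I_k.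

Definition homogeneous (A : set nat) (n k : nat) (pi : coloring A n k)
    (H : set nat) : Prop :=
  H `<=` A /\
  forall s t : nsubsets A n,
    nsubsets H n (val s) -> nsubsets H n (val t) -> pi s = pi t.

Definition tail (H : set nat) (m : nat) : set nat := [set j | H j /\ m < j].

Definition almost_homogeneous (A : set nat) (n k : nat) (pi : coloring A n k)
    (H : set nat) : Prop :=
  [/\ infinite_set H, H `<=` A & exists m, homogeneous pi (tail H m)].

Definition ramsey (I : set (set nat)) : Prop :=
  forall A, positive I A -> forall pi : coloring A 2 2,
    exists H, [/\ positive I H, H `<=` A & homogeneous pi H].

(* Main.v *)
Require Import Defs.
From mathcomp Require Import all_boot finmap.
From mathcomp Require Import boolp classical_sets cardinality.

(** The heart of the matter is that a Ramsey ideal handles countably many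
two-valued colorings of [n]-sets at once ([ramsey_stabilizes]).  The proof is
by induction on [n], starting from the trivial case [n = 0], and draws two
consequences from the partition property for pairs.

- A sequence of functions [f m : nat -> bool] is one map [x |-> (f m x)_m]
  into the Cantor space.  Following Sierpinski, color a pair [x < y] according
  to whether the image of [x] is lexicographically below that of [y].  On a
  homogeneous set the map is monotone, and a monotone sequence of the Cantor
  space converges: every [f m] is eventually constant ([ramsey_pointwise]).
- Coloring [x < y] by whether [F x < y] makes a positive set as sparse as any
  given [F] prescribes ([ramsey_thin]): no infinite set is homogeneous for the
  other color.

For the induction step, given colorings [c m] of [n.+1]-sets, the induction
hypothesis applied to the countably many colorings [r |-> c m (x |` r)] of
[n]-sets gives a positive set on which each of them takes a limit value
[l (x, m)] on the [n]-sets above some [N (x, m)].  The functions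
[l (_, m)] are then made eventually constant, and the set is thinned so that
an element [x] is followed only by elements above all the [N (x, m)] with
[m <= x].  The color that [c m] gives to an [n.+1]-set far enough out
is then [l (x, m)], where [x] is its minimum, hence the limit of [l (_, m)].

Colorings with [k m] values reduce to the two-valued case through the
countably many questions whether [pi m] takes the value [j], which yields (c).
Conversely, (b) for a constant sequence of colorings of pairs gives a positive
almost homogeneous set, and deleting finitely many points leaves it positive,
which yields (a). *)

Local Open Scope classical_set_scope.

(** Colorings are taken here as total functions on finite sets, which spares
any transport between the subtypes of [n]-sets of different sets. *)
Definition limit_color (H : set nat) (n : nat) (c : {fset nat} -> bool)
    (b : bool) : Prop :=
  exists N, forall s, nsubsets (tail H N) n s -> c s = b.

Definition stabilizes (I : set (set nat)) (n : nat) : Prop :=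
  forall A, positive I A -> forall c : nat -> {fset nat} -> bool,
  exists H, [/\ positive I H, H `<=` A &
    forall m, exists b, limit_color H n (c m) b].

Lemma infinite_unbounded (H : set nat) :
  infinite_set H -> forall N, exists2 y, H y & N < y.
Proof.
move=> infH N; apply: contrapT => noy; apply: infH.
apply: (sub_finite_set _ (finite_II N.+1)) => y Hy /=.
by rewrite ltnS leqNgt; apply/negP => Ny; apply: noy; exists y.
Qed.

Lemma nsubsetsS (A B : set nat) n s :
  A `<=` B -> nsubsets A n s -> nsubsets B n s.
Proof. by move=> AB [sA ?]; split=> // x /sA /AB. Qed.

(** Splitting off the minimum, rather than the maximum, leaves a remainder
lying in the tail above it; this is the form in which the induction on [n]
consumes an [n.+1]-set. *)
Lemma nsubsets_min (A : set nat) n s : nsubsets A n.+1 s ->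
  exists x r, [/\ s = (x |` r)%fset, A x & nsubsets (tail A x) n r].
Proof.
case=> sA sn.
have exs : exists x, x \in s.
  by apply/fset0Pn; rewrite -cardfs_gt0 sn.
have [x xs minx] := ex_minnP exs.
exists x, (s `\ x)%fset; split; [by rewrite fsetD1K | exact: sA|].
split=> [y /=|]; last by move: sn; rewrite (cardfsD1 x) xs => -[].
rewrite in_fsetD1 => /andP[yx ys]; split; first exact: sA.
by rewrite ltn_neqAle eq_sym yx minx.
Qed.

Lemma fset2_inj (x y u v : nat) : x < y -> u < v ->
  ([fset x; y] = [fset u; v])%fset -> x = u /\ y = v.
Proof.
move=> xy uv e.
have /fset2P xE : x \in [fset u; v]%fset by rewrite -e fset21.
have /fset2P yE : y \in [fset u; v]%fset by rewrite -e fset22.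
case: xE yE xy => -> [] -> //; rewrite ?ltnn //.
by move/(ltn_trans uv); rewrite ltnn.
Qed.

(** The partition property in terms of increasing pairs, with an arbitrary
relation in place of a coloring of two-element sets. *)
Lemma ramsey_relation (I : set (set nat)) : ramsey I ->
  forall A, positive I A -> forall P : nat -> nat -> Prop,
  exists H, [/\ positive I H, H `<=` A &
    (forall x y, H x -> H y -> x < y -> P x y) \/
    (forall x y, H x -> H y -> x < y -> ~ P x y)].
Proof.
move=> ramI A posA P.
pose Q s := exists x y, [/\ x < y, s = [fset x; y]%fset & P x y].
have QE x y : x < y -> Q [fset x; y]%fset <-> P x y.
  move=> xy; split=> [[u [v [uv e Puv]]]|Pxy]; last by exists x, y.
  by have [-> ->] := fset2_inj _ _ _ _ xy uv e.
pose pi : coloring A 2 2 := fun s => inord (`[< Q (val s) >] : nat).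
have [H [posH HA [_ homH]]] := ramI A posA pi.
exists H; split=> //.
have pair x y : H x -> H y -> x < y -> nsubsets H 2 [fset x; y]%fset.
  move=> Hx Hy xy; split; last by rewrite cardfs2 (ltn_eqF xy).
  by move=> z /=; rewrite in_fset2 => /orP[] /eqP ->.
have same x y u v : H x -> H y -> x < y -> H u -> H v -> u < v ->
    P x y -> P u v.
  move=> Hx Hy xy Hu Hv uv /(QE _ _ xy) Qxy; apply/(QE _ _ uv).
  have xyH := pair _ _ Hx Hy xy; have uvH := pair _ _ Hu Hv uv.
  have := homH (SigSub (mem_set (nsubsetsS _ _ _ _ HA xyH)))
               (SigSub (mem_set (nsubsetsS _ _ _ _ HA uvH))) xyH uvH.
  move/(congr1 val); rewrite /pi /= asboolT // !inordK ?ltnS ?leq_b1 //.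
  by case: asboolP.
have [[x [y [Hx Hy xy Pxy]]]|noP] :=
  pselect (exists x y, [/\ H x, H y, x < y & P x y]).
  by left=> u v Hu Hv uv; apply: (same x y).
by right=> x y Hx Hy xy Pxy; apply: noP; exists x, y.
Qed.

(** Only one color is possible: were [y <= F x] for all [x < y] in an infinite
set, its elements above [x] would be bounded by [F x]. *)
Lemma ramsey_thin (I : set (set nat)) : ramsey I ->
  forall A, positive I A -> forall F : nat -> nat,
  exists H, [/\ positive I H, H `<=` A &
    forall x y, H x -> H y -> x < y -> F x < y].
Proof.
move=> ramI A posA F.
have [H [posH HA [thin|crowded]]] :=
  ramsey_relation I ramI A posA (fun x y => F x < y); first by exists H.
have [x Hx _] := infinite_unbounded H posH.1 0.
have [y Hy] := infinite_unbounded H posH.1 (maxn x (F x)).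
by rewrite gtn_max => /andP[xy] /(crowded _ _ Hx Hy xy).
Qed.

(** Sierpinski's coloring: a sequence of points of the Cantor space that is
monotone for the lexicographic order converges, because once the coordinates
below [m] have settled, the coordinate [m] is itself monotone and so changes at
most once. *)
Lemma ramsey_pointwise (I : set (set nat)) : ramsey I ->
  forall A, positive I A -> forall f : nat -> nat -> bool,
  exists H, [/\ positive I H, H `<=` A &
    forall m, exists b N, forall x, tail H N x -> f m x = b].
Proof.
move=> ramI A posA f.
pose lex x y := exists m,
  [/\ forall i, i < m -> f i x = f i y, ~~ f m x & f m y].
have [H [posH HA lexH]] := ramsey_relation I ramI A posA lex.
exists H; split=> //.
(* [b0] is the value towards which settled coordinates may move: [true] if the
   sequence increases, [false] if it does not. *)
have [b0 mono] : exists b0, forall m x y, H x -> H y -> x < y ->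
    (forall i, i < m -> f i x = f i y) -> f m x = b0 -> f m y = b0.
  case: lexH => lexH; [exists true | exists false];
    move=> m x y Hx Hy xy agree fx; last first.
    apply: contra_notF (lexH _ _ Hx Hy xy) => fy.
    by exists m; split=> //; rewrite fx.
  have [k [agree' nfx fy]] := lexH _ _ Hx Hy xy.
  have [km|mk|<- //] := ltngtP k m; last by rewrite -agree'.
  by rewrite agree ?fy // in nfx.
have agreement m : exists N, forall x y, tail H N x -> tail H N y ->
    forall i, i < m -> f i x = f i y.
  elim: m => [|m [N agree]]; first by exists 0.
  have [[x [Hx Nx] fx]|nox] := pselect (exists2 x, tail H N x & f m x = b0).
    have settled z : tail H x z -> f m z = b0.
      move=> [Hz xz]; apply: (mono m x) => //; apply: agree => //.
      by split=> //; apply: ltn_trans xz.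
    exists x => y z [Hy xy] [Hz xz] i; rewrite ltnS leq_eqVlt.
    case/predU1P => [->|im]; first by rewrite !settled.
    by apply: agree => //; split=> //; apply: ltn_trans Nx _.
  (* The value [b0] never occurs beyond [N], so coordinate [m] is constantly
     [~~ b0] there. *)
  exists N => y z ty tz i; rewrite ltnS leq_eqVlt.
  case/predU1P => [->|im]; last exact: agree.
  have out w : tail H N w -> f m w = ~~ b0.
    move=> tw; have [fw|] := eqVneq (f m w) b0; first by case: nox; exists w.
    by case: (f m w) (b0) => [] [].
  by rewrite !out.
move=> m; have [N agree] := agreement m.+1.
have [x0 Hx0 Nx0] := infinite_unbounded H posH.1 N.
by exists (f m x0), N => x tx; apply: agree.
Qed.

Lemma stabilizes_countable (I : set (set nat)) n : stabilizes I n ->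
  forall (T : countType) A, positive I A -> forall c : T -> {fset nat} -> bool,
  exists H, [/\ positive I H, H `<=` A &
    forall t, exists b, limit_color H n (c t) b].
Proof.
move=> stab T A posA c.
have [H [posH HA lim]] := stab A posA
  (fun m s => if choice.unpickle m is Some t then c t s else false).
exists H; split=> // t; have := lim (choice.pickle t).
by rewrite choice.pickleK.
Qed.

(** The diagonal step: only the colorings [m <= x] can be made to obey [x], as
one thinning function must serve for all [m]; this is why each coloring
becomes constant merely on a tail. *)
Lemma ramsey_stabilizes (I : set (set nat)) n : ramsey I -> stabilizes I n.
Proof.
move=> ramI; elim: n => [|n IHn] A posA c.
  exists A; split=> // m; exists (c m fset0), 0 => s [_ /cardfs0_eq -> //].
have [B [posB BA limB]] := stabilizes_countable I n IHn (nat * nat)%type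
  A posA (fun p r => c p.2 (p.1 |` r)%fset).
have [l lP] := choice limB; have [N NP] := choice lP.
have [C [posC CB limC]] := ramsey_pointwise I ramI B posB (fun m x => l (x, m)).
have [D [posD DC thinD]] := ramsey_thin I ramI C posC
  (fun x => \max_(m < x.+1) N (x, m : nat)).
exists D; split=> //; first by move=> x /DC /CB /BA.
move=> m; have [b [M limM]] := limC m; exists b, (maxn m M) => s.
move=> /nsubsets_min[x [r [-> [Dx]]]]; rewrite gtn_max => /andP[mx Mx] rD.
rewrite -(limM x); last by split=> //; apply: DC.
apply: (NP (x, m)) => /=; apply: nsubsetsS rD => y [[Dy _] xy].
split; first by apply: CB; apply: DC.
apply: leq_ltn_trans (thinD x y Dx Dy xy).
exact: (leq_bigmax (Ordinal (leqW mx : m < x.+1))).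
Qed.

Lemma positive_tail (I : set (set nat)) (idealI : is_ideal I) H m :
  positive I H -> positive I (tail H m).
Proof.
move=> [_ nIH].
have nI : ~ I (tail H m).
  move=> It; apply: nIH.
  apply: (ideal_subset idealI _ (ideal_setU idealI
    (ideal_finite idealI (finite_II m.+1)) It)) => x Hx.
  by have [xm|mx] := leqP x m; [left | right].
by split=> // /(ideal_finite idealI).
Qed.

Theorem theorem3p16 (I : set (set nat)) (idealI : is_ideal I) :
  let b :=
    forall n : nat, 2 <= n ->
    forall A : set nat, positive I A ->
    forall pi : nat -> coloring A n 2,
    exists H : set nat,
      [/\ positive I H, H `<=` A & forall m, almost_homogeneous (pi m) H] in
  let c :=
    forall n : nat, 2 <= n ->
    forall k : nat -> nat, (forall m, 2 <= k m) ->
    forall A : set nat, positive I A ->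
    forall pi : forall m : nat, coloring A n (k m),
    exists H : set nat,
      [/\ positive I H, H `<=` A & forall m, almost_homogeneous (pi m) H] in
  (ramsey I <-> b) /\ (b <-> c).
Proof.
move=> b c.
have b_ramsey : b -> ramsey I.
  move=> Hb A posA pi.
  have [H [posH HA ah]] := Hb 2 isT A posA (fun=> pi).
  have [_ _ [m homH]] := ah 0.
  by exists (tail H m); split=> //; [exact: positive_tail | exact: homH.1].
have c_b : c -> b by move=> Hc n n2 A posA pi; apply: (Hc n n2 (fun=> 2)).
suff ramsey_c : ramsey I -> c by split; split; auto.
move=> ramI n _ k _ A posA pi.
(* The two-valued colorings to stabilize: does [pi m] take the value [j]? *)
pose hits (p : nat * nat) (s : {fset nat}) :=
  `[< exists2 t : nsubsets A n, val t = s & val (pi p.1 t) = p.2 >].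
have [H [posH HA lim]] := stabilizes_countable I n (ramsey_stabilizes I n ramI)
  (nat * nat)%type A posA hits.
exists H; split=> // m; split=> //; first exact: posH.1.
have [l lP] := choice lim; have [N NP] := choice lP.
(* Beyond this bound all [k m] questions about [pi m] have a fixed answer, in
   particular the one whose [j] is the color of a given set. *)
exists (\max_(j < k m) N (m, j : nat)); split; first by move=> x [/HA].
move=> s t sH tH; set M := \max_(j < _) _ in sH tH.
have NM : N (m, val (pi m s)) <= M by apply: (leq_bigmax (pi m s)).
have hitl u : nsubsets (tail H M) n u ->
    hits (m, val (pi m s)) u = l (m, val (pi m s)).
  move=> uH; apply: NP; apply: nsubsetsS uH => x [Hx Mx]; split=> //.
  exact: leq_ltn_trans Mx.
have : hits (m, val (pi m s)) (val t).
  by rewrite hitl // -(hitl (val s)) //; apply/asboolP; exists s.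
by move=> /asboolP[u /val_inj -> /val_inj].
Qed.
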